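(* Let $A\in\mathbb{C}^{N\times N}$, $\mathbf{b}\in\mathbb{C}^N$, $S\in\mathbb{C}^{s\times N}$, and let the columns of $V_m\in\mathbb{C}^{N\times m}$ form a basis of $\mathcal{K}_m(A,\mathbf{b})$. Let $f(z)=\int_\Gamma(t+z)^{-1}\,\mathrm{d}\mu(t)$, and suppose that $(SV_m)^H(tSV_m+SAV_m)$ is nonsingular for all $t\in\Gamma$. Then the sketched FOM approximant $$\widehat{\mathbf{f}}_m := V_m\int_\Gamma\big[(SV_m)^H(tSV_m+SAV_m)\big]^{-1}\,\mathrm{d}\mu(t)\,(SV_m)^H(S\mathbf{b})$$ satisfies $$\widehat{\mathbf{f}}_m = V_m(V_m^HS^HSV_m)^{-1}\,f\big(V_m^HS^HSAV_m(V_m^HS^HSV_m)^{-1}\big)\,(SV_m)^H(S\mathbf{b}).$$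
   Context: $^H$ is the conjugate transpose, and $\mathcal{K}_m(A,\mathbf{b})=\mathrm{span}\{\mathbf{b},A\mathbf{b},\dots,A^{m-1}\mathbf{b}\}$. The function $f$ is represented by an integral over a curve $\Gamma$ with respect to $\mu$ (for instance $\Gamma=[0,\infty)$ for a Stieltjes function, or a Cauchy integral over a closed contour), and the function of a square matrix $M$ is given by $f(M)=\int_\Gamma(tI+M)^{-1}\,\mathrm{d}\mu(t)$; the representation is assumed to be valid (the integral exists and represents $f$) for the matrix $M=V_m^HS^HSAV_m(V_m^HS^HSV_m)^{-1}$. *)

(* Defs.v *)
From HB Require Import structures.
From mathcomp Require Import all_boot all_order all_algebra.
From mathcomp Require Import all_classical all_reals all_analysis.
From mathcomp Require Import complex.
Set Implicit Arguments.
Unset Strict Implicit.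
Unset Printing Implicit Defensive.
Import Order.TTheory GRing.Theory Num.Theory.
Import numFieldNormedType.Exports.
Local Open Scope classical_set_scope.
Local Open Scope ring_scope.
Local Open Scope complex_scope.
Local Open Scope sesquilinear_scope.

(* R[i] with its Borel sigma-algebra; the topology of R[i]^o is the one induced
   by the modulus. *)
Definition borelC (R : realType) := g_sigma_algebraType (@open R[i]^o).

HB.instance Definition _ (R : realType) := Measurable.on (borelC R).

(* A complex measure d mu = h d nu, where nu is a positive (possibly infinite)
   Borel measure and h a measurable density.  h = 1 gives the positive measures
   of Stieltjes functions; a contour integral of g(t) dt is obtained with nu the
   arc length and h = g times the unit tangent. *)
Record complex_measure (R : realType) := ComplexMeasure {
  cm_base : {measure set (borelC R) -> \bar R} ;
  cm_density : borelC R -> borelC R ;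
  cm_density_measurable : measurable_fun setT cm_density }.

Definition is_curve (R : realType) (Gamma : set R[i]) : Prop :=
  exists (J : interval R) (gamma : R -> R[i]^o),
    [/\ [set` J] !=set0, {within [set` J], continuous gamma}
      & Gamma = gamma @` [set` J]].

Section Integrals.
Variables (R : realType) (mu : complex_measure R) (Gamma : set R[i]).
Local Notation C := R[i].
Local Notation nu := (cm_base mu).

Definition cintegrand (g : C -> C) (t : borelC R) : C := g t * cm_density mu t.

Definition cintegrable (g : C -> C) : Prop :=
  nu.-integrable Gamma (EFin \o (fun t => complex.Re (cintegrand g t))) /\
  nu.-integrable Gamma (EFin \o (fun t => complex.Im (cintegrand g t))).

(* As for the library's integrals, the value is meaningful only under
   [cintegrable g]. *)
Definition cintegral (g : C -> C) : C :=
  (\int[nu]_(t in Gamma) complex.Re (cintegrand g t)) +i*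
  (\int[nu]_(t in Gamma) complex.Im (cintegrand g t)).

Definition mxintegrable (m n : nat) (F : C -> 'M[C]_(m, n)) : Prop :=
  forall i j, cintegrable (fun t => F t i j).

Definition mxintegral (m n : nat) (F : C -> 'M[C]_(m, n)) : 'M[C]_(m, n) :=
  \matrix_(i, j) cintegral (fun t => F t i j).

(* The function f represented by (Gamma, mu), at a scalar and at a square
   matrix; [resolvent_funmx_scalar] relates the two. *)
Definition resolvent_fun (z : C) : C := cintegral (fun t => (t + z)^-1).

Definition resolvent_funmx (n : nat) (M : 'M[C]_n) : 'M[C]_n :=
  mxintegral (fun t => invmx (t%:M + M)).

Lemma resolvent_funmx_scalar (n : nat) (z : C) :
  resolvent_funmx (z%:M : 'M[C]_n) = (resolvent_fun z)%:M.
Proof.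
apply/matrixP => i j; rewrite !mxE /resolvent_fun /cintegral /cintegrand.
have E t : invmx (t%:M + z%:M) i j = (t + z)^-1 *+ (i == j) :> C.
  by rewrite -raddfD /= invmx_scalar mxE.
case: eqVneq E => [_|_] E /=.
  by rewrite mulr1n; congr (_ +i* _); apply: eq_Rintegral => t _; rewrite E.
rewrite mulr0n.
have R0 (k : borelC R -> R) : (forall t, k t = 0) ->
    \int[nu]_(t in Gamma) k t = 0.
  move=> k0; rewrite (_ : k = cst 0); last by apply/funext.
  by rewrite /Rintegral integral0.
by rewrite !R0 // => t; rewrite E mulr0n mul0r.
Qed.

End Integrals.

(* K_m(A, b) = span {b, A b, ..., A^(m-1) b} *)
Definition krylov (R : realType) (N m : nat) (A : 'M[R[i]]_N) (b : 'cV[R[i]]_N)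
    : {vspace 'cV[R[i]]_N} :=
  <<[seq A ^+ k *m b | k <- iota 0 m]>>%VS.

Definition cols_basis (R : realType) (N m : nat) (V : 'M[R[i]]_(N, m))
    (U : {vspace 'cV[R[i]]_N}) : bool :=
  basis_of U [seq col j V | j <- enum 'I_m].

Definition sketched_fom (R : realType) (mu : complex_measure R)
    (Gamma : set R[i]) (N m s : nat) (A : 'M[R[i]]_N) (b : 'cV[R[i]]_N)
    (S : 'M[R[i]]_(s, N)) (V : 'M[R[i]]_(N, m)) : 'cV[R[i]]_N :=
  V *m mxintegral mu Gamma
         (fun t => invmx ((S *m V)^t* *m (t *: (S *m V) + S *m A *m V)))
    *m (S *m V)^t* *m (S *m b).

(* Main.v *)
Require Import Defs.
From HB Require Import structures.
From mathcomp Require Import all_boot all_order all_algebra.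
From mathcomp Require Import all_classical all_reals all_analysis.
From mathcomp Require Import complex.
Import Order.TTheory GRing.Theory Num.Theory.
Import numFieldNormedType.Exports.
Local Open Scope classical_set_scope.
Local Open Scope ring_scope.
Local Open Scope complex_scope.
Local Open Scope sesquilinear_scope.

Set Implicit Arguments.
Unset Strict Implicit.

(* Put W = S V, G = W^H W and H = W^H S A V.  Nonsingularity of W^H (t W + S A V)
   at a single t forces W to have full column rank, so G is invertible, and
   then W^H (t W + S A V) = t G + H = (t I + H G^-1) G.  Inverting and pulling
   the constant factor G^-1 out of the integral gives the formula.  Linearity
   of the integral needs Gamma to be a Borel set: a curve is a countable union
   of compact sets. *)

(** * Borel measurability of curves *)

Lemma lower_itv_bound_seq (R : realType) (a : itv_bound R) :
  a <> +oo%O -> exists lo : nat -> R,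
  forall x, (a <= BLeft x)%O <-> exists n, lo n <= x.
Proof.
case: a => [[] y|[]] // _.
- by exists (fun=> y) => x; rewrite bnd_simp; split=> [yx|[]//]; exists 0%N.
(* Open bound: a strict inequality leaves room for some [1/(n+1)]. With [n] in place of [n.+1], the
   term at [0] would be [y] itself, as [0^-1 = 0], and would admit [x = y]. *)
- exists (fun n => y + n.+1%:R^-1) => x; rewrite bnd_simp; split=> [yx|[n]].
    by have [n /ltW nx] := ltr_add_invr yx; exists n.
  by apply: lt_le_trans; rewrite ltrDl invr_gt0.
- exists (fun n => - n%:R) => x; split=> // _.
  exists (Num.trunc (- x)).+1; rewrite lerNl ltW //.
  exact: truncnS_gt.
Qed.

Lemma upper_itv_bound_seq (R : realType) (b : itv_bound R) :
  b <> -oo%O -> exists hi : nat -> R,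
  forall x, (BRight x <= b)%O <-> exists n, x <= hi n.
Proof.
case: b => [[] y|[]] // _.
- exists (fun n => y - n.+1%:R^-1) => x; rewrite bnd_simp; split=> [xy|[n]].
    have [n /ltW nx] := ltr_add_invr xy.
    by exists n; rewrite lerBrDr.
  by move=> /le_lt_trans; apply; rewrite ltrBlDr ltrDl invr_gt0.
- by exists (fun=> y) => x; rewrite bnd_simp; split=> [yx|[]//]; exists 0%N.
- exists (fun n => n%:R) => x; split=> // _.
  by exists (Num.trunc x).+1; rewrite ltW // truncnS_gt.
Qed.

(** A point of [J] rules out [+oo] as lower bound and [-oo] as upper bound. The two ends are
    approached independently, hence the double union; some of its segments may be empty. *)
Lemma itv_bigcup_segment (R : realType) (J : interval R) : [set` J] !=set0 ->
  exists lo hi : nat -> R, [set` J] = \bigcup_n \bigcup_k `[lo n, hi k]%classic.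
Proof.
case: J => a b [z]; rewrite /= itv_boundlr => /andP[az zb].
have [|lo loE] := @lower_itv_bound_seq R a; first by move=> aE; rewrite aE in az.
have [|hi hiE] := @upper_itv_bound_seq R b; first by move=> bE; rewrite bE in zb.
exists lo, hi; apply/seteqP; split=> x /=; rewrite ?itv_boundlr.
  move=> /andP[/loE[n nx] /hiE[k xk]].
  by exists n => //; exists k => //=; rewrite in_itv /= nx.
move=> [n _ [k _]]; rewrite /= !in_itv /= => /andP[nx xk].
by apply/andP; split; [apply/loE; exists n|apply/hiE; exists k].
Qed.

(* The image of a segment is compact, hence closed. *)
Lemma curve_measurable (R : realType) (Gamma : set R[i]) :
  is_curve Gamma -> measurable (Gamma : set (borelC R)).
Proof.
move=> [J [g [J0 gJ ->]]].
have [lo [hi JE]] := itv_bigcup_segment J0.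
rewrite JE image_bigcup; apply: bigcup_measurable => n _.
rewrite image_bigcup; apply: bigcup_measurable => k _.
rewrite -[X in measurable X]setCK; apply: measurableC.
apply: sub_sigma_algebra; apply: closed_openC.
apply: (@compact_closed R[i]^o); first exact: norm_hausdorff.
apply: continuous_compact; last exact: segment_compact.
apply: continuous_subspaceW gJ; rewrite JE => x xnk.
by exists n => //; exists k.
Qed.

(** * Linearity of the complex and matrix integrals *)

Section ComplexIntegral.
Variables (R : realType) (mu : complex_measure R) (Gamma : set R[i]).
Hypothesis mGamma : measurable (Gamma : set (borelC R)).

Lemma eq_cintegral (f g : R[i] -> R[i]) : {in Gamma, f =1 g} ->
  cintegral mu Gamma f = cintegral mu Gamma g.
Proof.
move=> fg; congr (_ +i* _); apply: eq_Rintegral => t tG;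
  by rewrite /cintegrand fg.
Qed.

Lemma cintegrable0 : cintegrable mu Gamma (fun=> 0).
Proof.
by split; rewrite (_ : EFin \o _ = cst 0%E); try exact: integrable0;
  apply/funext => t /=; rewrite /cintegrand mul0r.
Qed.

Let ReD (x y : R[i]) : complex.Re (x + y) = complex.Re x + complex.Re y.
Proof. by case: x y => ? ? []. Qed.
Let ImD (x y : R[i]) : complex.Im (x + y) = complex.Im x + complex.Im y.
Proof. by case: x y => ? ? []. Qed.

Lemma cintegrableD (f g : R[i] -> R[i]) :
  cintegrable mu Gamma f -> cintegrable mu Gamma g ->
  cintegrable mu Gamma (fun t => f t + g t).
Proof.
move=> [fr fi] [gr gi]; split.
- rewrite (_ : EFin \o _ = (EFin \o (fun t => complex.Re (cintegrand mu f t)))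
    \+ (EFin \o (fun t => complex.Re (cintegrand mu g t))))%E.
    exact: integrableD.
  by apply/funext => t /=; rewrite /cintegrand mulrDl ReD EFinD.
- rewrite (_ : EFin \o _ = (EFin \o (fun t => complex.Im (cintegrand mu f t)))
    \+ (EFin \o (fun t => complex.Im (cintegrand mu g t))))%E.
    exact: integrableD.
  by apply/funext => t /=; rewrite /cintegrand mulrDl ImD EFinD.
Qed.

Lemma cintegralD (f g : R[i] -> R[i]) :
  cintegrable mu Gamma f -> cintegrable mu Gamma g ->
  cintegral mu Gamma (fun t => f t + g t) =
  cintegral mu Gamma f + cintegral mu Gamma g.
Proof.
move=> [fr fi] [gr gi]; rewrite /cintegral.
under eq_Rintegral do rewrite /cintegrand mulrDl ReD.
rewrite RintegralD //.
under [X in _ +i* X]eq_Rintegral do rewrite /cintegrand mulrDl ImD.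
by rewrite RintegralD.
Qed.

(** The minus sign is attached to the factor [complex.Im x], so that additivity and real scaling of
    integrals suffice, without a rule for differences. *)
Let ReM (x y : R[i]) : complex.Re (x * y) =
  complex.Re x * complex.Re y + - complex.Im x * complex.Im y.
Proof. by case: x y => ? ? [? ?] /=; rewrite mulNr. Qed.
Let ImM (x y : R[i]) : complex.Im (x * y) =
  complex.Re x * complex.Im y + complex.Im x * complex.Re y.
Proof. by case: x y => ? ? [? ?]. Qed.

(** Each part of [c * f] is a real combination of both parts of [f] times the density, so each
    conclusion draws on both integrability hypotheses. *)
Lemma cintegrableZl (c : R[i]) (f : R[i] -> R[i]) :
  cintegrable mu Gamma f -> cintegrable mu Gamma (fun t => c * f t).
Proof.
move=> [fr fi]; split.
- under eq_fun do rewrite /cintegrand -mulrA.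
  rewrite (_ : EFin \o _ =
    (fun t => (complex.Re c)%:E * (complex.Re (cintegrand mu f t))%:E) \+
    (fun t => (- complex.Im c)%:E * (complex.Im (cintegrand mu f t))%:E))%E.
    by apply: integrableD => //; exact: integrableZl.
  by apply/funext => t /=; rewrite ReM EFinD !EFinM.
- under eq_fun do rewrite /cintegrand -mulrA.
  rewrite (_ : EFin \o _ =
    (fun t => (complex.Re c)%:E * (complex.Im (cintegrand mu f t))%:E) \+
    (fun t => (complex.Im c)%:E * (complex.Re (cintegrand mu f t))%:E))%E.
    by apply: integrableD => //; exact: integrableZl.
  by apply/funext => t /=; rewrite ImM EFinD !EFinM.
Qed.

Lemma cintegralZl (c : R[i]) (f : R[i] -> R[i]) :
  cintegrable mu Gamma f ->
  cintegral mu Gamma (fun t => c * f t) = c * cintegral mu Gamma f.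
Proof.
move=> [fr fi].
have Zr (r : R) (h : R[i] -> R) :
    (cm_base mu).-integrable Gamma (EFin \o h) ->
    (cm_base mu).-integrable Gamma (EFin \o (fun t => r * h t)).
  by move=> ih; rewrite (_ : EFin \o _ = fun t => r%:E * (h t)%:E)%E;
    [exact: integrableZl|apply/funext => t /=; rewrite EFinM].
apply/eqP; rewrite eq_complex; apply/andP; split; apply/eqP.
- rewrite ReM /=; under eq_Rintegral do rewrite /cintegrand -mulrA ReM.
  by rewrite RintegralD ?RintegralZl //; exact: Zr.
- rewrite ImM /=; under eq_Rintegral do rewrite /cintegrand -mulrA ImM.
  by rewrite RintegralD ?RintegralZl //; exact: Zr.
Qed.

Lemma cintegral0 : cintegral mu Gamma (fun=> 0) = 0.
Proof.
have /= := cintegralZl 0 cintegrable0.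
by rewrite !mul0r.
Qed.

Lemma cintegral_sum (I : Type) (r : seq I) (f : I -> R[i] -> R[i]) :
  (forall i, cintegrable mu Gamma (f i)) ->
  cintegral mu Gamma (fun t => \sum_(i <- r) f i t) =
  \sum_(i <- r) cintegral mu Gamma (f i).
Proof.
move=> fi; elim: r => [|i r IHr].
  by under eq_fun do rewrite big_nil; rewrite big_nil cintegral0.
under eq_fun do rewrite big_cons.
rewrite big_cons -IHr cintegralD //.
(* What remains is the side condition of [cintegralD]: integrability of the tail sum. *)
elim: r {IHr} => [|j r IHr].
  by under eq_fun do rewrite big_nil; exact: cintegrable0.
by under eq_fun do rewrite big_cons; exact: cintegrableD.
Qed.

Lemma eq_mxintegral (m n : nat) (F G : R[i] -> 'M[R[i]]_(m, n)) :
  {in Gamma, F =1 G} -> mxintegral mu Gamma F = mxintegral mu Gamma G.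
Proof.
move=> FG; apply/matrixP => i j; rewrite !mxE; apply: eq_cintegral => t tG.
by rewrite FG.
Qed.

(** Each entry of [B *m F t] is a finite combination of entries of [F t] with coefficients constant
    in [t]. *)
Lemma mxintegralMl (m n p : nat) (B : 'M[R[i]]_(m, n))
    (F : R[i] -> 'M[R[i]]_(n, p)) :
  mxintegrable mu Gamma F ->
  mxintegral mu Gamma (fun t => B *m F t) = B *m mxintegral mu Gamma F.
Proof.
move=> iF; apply/matrixP => i j; rewrite !mxE.
under eq_fun do rewrite mxE.
rewrite cintegral_sum => [|k]; last exact: cintegrableZl.
by apply: eq_bigr => k _; rewrite cintegralZl // mxE.
Qed.

End ComplexIntegral.

(** * Matrix algebra and the closed formula *)

Lemma invmx_mul (K : comUnitRingType) (n : nat) (A B : 'M[K]_n) :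
  A \in unitmx -> B \in unitmx -> invmx (A *m B) = invmx B *m invmx A.
Proof.
move=> uA uB; have uAB : A *m B \in unitmx by rewrite unitmx_mul uA.
apply: (can_inj (mulKmx uAB)).
by rewrite mulmxV // mulmxA mulmxK // mulmxV.
Qed.

(* A unit [W^H X] makes the rows of [W^H] independent, and
   [u W^H W u^H = |u W^H|^2]. *)
Lemma gram_unitmx (C : numClosedFieldType) (s m : nat) (W X : 'M[C]_(s, m)) :
  W^t* *m X \in unitmx -> W^t* *m W \in unitmx.
Proof.
move=> WX; rewrite -row_free_unit; apply/row_freeP.
suff K0 : kermx (W^t* *m W) = 0.
  by apply/row_freeP; rewrite -kermx_eq0 K0.
apply/eqP/rowV0P => u /sub_kermxP uWW.
have uW : u *m W^t* = 0.
  have [//|/dotmx_is_dotmx] := eqVneq (u *m W^t* ) 0.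
  rewrite dotmxE trmx_mul map_mxM trmxCK mulmxA -(mulmxA u) uWW mul0mx.
  by rewrite mxE ltxx.
by rewrite -[u](mulmxK WX) mulmxA uW !mul0mx.
Qed.

Unset Implicit Arguments.
Set Strict Implicit.

Theorem mainTheorem3 (R : realType) (N m s : nat)
    (A : 'M[R[i]]_N) (b : 'cV[R[i]]_N) (S : 'M[R[i]]_(s, N))
    (V : 'M[R[i]]_(N, m)) (hV : cols_basis V (krylov m A b))
    (Gamma : set R[i]) (hGamma : is_curve Gamma) (mu : complex_measure R)
    (hns : forall t : R[i], Gamma t ->
       (S *m V)^t* *m (t *: (S *m V) + S *m A *m V) \in unitmx)
    (M : 'M[R[i]]_m)
    (hM : M = V^t* *m S^t* *m S *m A *m V *m invmx (V^t* *m S^t* *m S *m V))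
    (hf : mxintegrable mu Gamma (fun t : R[i] => invmx (t%:M + M))) :
  sketched_fom mu Gamma A b S V =
  V *m invmx (V^t* *m S^t* *m S *m V) *m resolvent_funmx mu Gamma M
    *m (S *m V)^t* *m (S *m b).
Proof.
have SVE : (S *m V)^t* = V^t* *m S^t* by rewrite trmx_mul map_mxM.
set G := V^t* *m S^t* *m S *m V in hM *.
have GE : G = (S *m V)^t* *m (S *m V) by rewrite SVE !mulmxA.
have uG : G \in unitmx.
  (* A curve has a nonempty parameter interval, which supplies the point [g x] of [Gamma] at which
     [hns] is applied. *)
  have [J [g [[x Jx] _ GammaE]]] := hGamma.
  rewrite GE; apply: gram_unitmx (hns (g x) _).
  by rewrite GammaE; exists x.
have factor t : (S *m V)^t* *m (t *: (S *m V) + S *m A *m V) =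
    (t%:M + M) *m G.
  rewrite mulmxDr mulmxDl mul_scalar_mx -scalemxAr -GE; congr (_ + _).
  by rewrite hM mulmxKV // SVE !mulmxA.
have inv_factor t : Gamma t ->
    invmx ((S *m V)^t* *m (t *: (S *m V) + S *m A *m V)) =
    invmx G *m invmx (t%:M + M).
  move=> /hns; rewrite factor => uMG.
  (* Invertibility of [t%:M + M] is read off from that of the product. *)
  move: uMG; rewrite unitmx_mul => /andP[uM _].
  exact: invmx_mul.
(* The integrands are compared on [Gamma] only: elsewhere the matrices may be singular, and [invmx]
   then returns its argument. *)
rewrite /sketched_fom (@eq_mxintegral _ _ _ _ _ _
  (fun t => invmx G *m invmx (t%:M + M))); last first.
  by move=> t /set_mem; exact: inv_factor.
by rewrite mxintegralMl ?mulmxA //; exact: curve_measurable.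
Qed.
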